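(* Let $g\colon \mathbb{R}^n\to(-\infty,+\infty]$ be proper, convex and lower semicontinuous, let $A\in\mathbb{R}^{m\times n}$, $b\in\mathbb{R}^m$, and $f(x)=\frac12\|Ax-b\|^2$. Assume that the solution set $S$ of the problem $$\min_{x\in\mathbb{R}^n} g(x)\quad\text{s.t.}\quad x\in\operatorname{argmin} f \qquad (P)$$ is nonempty. Let $\tau,\lambda>0$ with $\lambda\|A\|^2<1$, and set $\sigma=\lambda/\tau$. Let $x^0\in\mathbb{R}^n$ be arbitrary, $s^0=x^0$, and let $(x^k)$, $(s^k)$ be generated for $k\ge 0$ by $$z^k=\frac{x^k+k s^k}{k+1},\qquad x^{k+1}=\operatorname{prox}_{\tau g}\bigl(x^k-(k+1)\lambda\nabla f(z^k)\bigr),\qquad s^{k+1}=\frac{x^{k+1}+k s^k}{k+1}.$$ Let $f_*=\min_x f(x)$, $g_*=\min_{x\in\operatorname{argmin} f} g(x)$ and $F_k(x)=g(x)+\sigma k\,(f(x)-f_* )$. Then: (i) $F_k(s^k)-g_*= O(1/k)$, meaning that there is a constant $C$ with $F_k(s^k)-g_*\le C/k$ for all $k\ge1$. (ii) If strong duality holds for problem $(P)$, then $(x^k)$ and $(s^k)$ converge to a solution of $(P)$, and $f(x^k)-f_*=O(1/k)$, $f(s^k)-f_*=O(1/k^2)$, $|F_k(s^k)-g_*|=O(1/k)$, $|g(s^k)-g_*|=O(1/k)$. (iii) If $S$ is bounded and $g$ is bounded below, then all cluster points of $(s^k)$ belong to $S$ and $f(s^k)-f_*=o(1/k)$.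
   Context: $\mathbb{R}^n$ carries its inner product $\langle\cdot,\cdot\rangle$ and norm $\|\cdot\|=\sqrt{\langle\cdot,\cdot\rangle}$; $\|A\|$ is the operator norm. $\operatorname{prox}_{\tau g}(z)=\operatorname{argmin}_x\{\tau g(x)+\frac12\|x-z\|^2\}$, and $\nabla f(x)=A^\top(Ax-b)$. Strong duality for $(P)$ means that the problem, written with constraint $A^\top A x=A^\top b$, has a saddle point: there exists $(x^*,u^* )\in\mathbb{R}^n\times\mathbb{R}^n$ that is a saddle point of $\min_x\max_u\; g(x)+\langle u,A^\top A x-A^\top b\rangle$ (so $x^*\in S$ and $0\in A^\top A u^*+\partial g(x^* )$). The $O(\cdot)$ and $o(\cdot)$ statements are as $k\to\infty$. *)

(* Defs.v *)
From mathcomp Require Import all_boot all_order all_algebra.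
From mathcomp Require Import all_classical all_reals all_analysis.

Set Implicit Arguments.
Unset Strict Implicit.
Unset Printing Implicit Defensive.

Import Order.TTheory GRing.Theory Num.Theory.
Import numFieldNormedType.Exports.

Local Open Scope classical_set_scope.
Local Open Scope ring_scope.

Section Euclidean.
Context {R : realType}.

Definition inner n (u v : 'cV[R]_n) : R := \sum_(i < n) u i ord0 * v i ord0.

(* The norm [`| x |] that the library puts on matrices is the sup norm; it
   induces the same topology as [enorm]. *)
Definition enorm n (x : 'cV[R]_n) : R := Num.sqrt (inner x x).

Definition opnorm m n (A : 'M[R]_(m, n)) : R :=
  sup [set enorm (A *m x) | x in [set x : 'cV[R]_n | enorm x <= 1]].

End Euclidean.

Section ExtendedFunctions.
Context {R : realType}.
Local Open Scope ereal_scope.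

Definition proper_fun T (g : T -> \bar R) : Prop :=
  (forall x, g x != -oo) /\ (exists x, g x != +oo).

Definition econvex n (g : 'cV[R]_n -> \bar R) : Prop :=
  forall (x y : 'cV[R]_n) (t : R), (0 < t < 1)%R ->
    g (t *: x + (1 - t) *: y)%R <= t%:E * g x + (1 - t)%:E * g y.

(* Minimizers of [h] over [D]. As usual for extended-valued functions, the set
   is empty when [h] is identically [+oo] on [D]. *)
Definition argmin T (D : set T) (h : T -> \bar R) : set T :=
  [set x | [/\ D x, h x < +oo & forall y, D y -> h x <= h y]].

(* The proximal operator, as the set of minimizers (a singleton when [g] is
   proper, convex and lower semicontinuous and [0 < tau]). *)
Definition prox n (tau : R) (g : 'cV[R]_n -> \bar R) (z : 'cV[R]_n) :
    set 'cV[R]_n :=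
  argmin setT (fun x => tau%:E * g x + (2^-1 * enorm (x - z) ^+ 2)%:E).

(* Same shape as the library's [u =O_\oo v], for a sequence [u] that may take
   infinite values at finitely many indices. *)
Definition ebigO (u : nat -> \bar R) (v : nat -> R) : Prop :=
  exists C : R, \forall k \near \oo, `|u k| <= (C * `|v k|)%:E.

End ExtendedFunctions.

Section Problem.
Context {R : realType} {m n : nat}.
Variables (g : 'cV[R]_n -> \bar R) (A : 'M[R]_(m, n)) (b : 'cV[R]_m).

Definition lsq (x : 'cV[R]_n) : R := 2^-1 * enorm (A *m x - b) ^+ 2.

Definition grad_lsq (x : 'cV[R]_n) : 'cV[R]_n := A^T *m (A *m x - b).

Definition argmin_lsq : set 'cV[R]_n := argmin setT (EFin \o lsq).

Definition lsq_min : R := inf (range lsq).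

Definition solutions : set 'cV[R]_n := argmin argmin_lsq g.

Definition opt_val : \bar R := ereal_inf (g @` argmin_lsq).

Definition penalized (sigma : R) (k : nat) (x : 'cV[R]_n) : \bar R :=
  (g x + (sigma * k%:R * (lsq x - lsq_min))%:E)%E.

Definition lagrangian (x u : 'cV[R]_n) : \bar R :=
  (g x + (inner u (A^T *m A *m x - A^T *m b))%:E)%E.

Definition strong_duality : Prop :=
  exists xs us : 'cV[R]_n, forall x u : 'cV[R]_n,
    (lagrangian xs u <= lagrangian xs us)%E /\
    (lagrangian xs us <= lagrangian x us)%E.

End Problem.

(* Main.v *)
Require Import Defs.
From mathcomp Require Import all_boot all_order all_algebra.
From mathcomp Require Import all_classical all_reals all_analysis.
From mathcomp Require Import ring lra.

Set Implicit Arguments.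
Unset Strict Implicit.
Unset Printing Implicit Defensive.

Import Order.TTheory GRing.Theory Num.Theory.
Import numFieldNormedType.Exports.

Local Open Scope classical_set_scope.
Local Open Scope ring_scope.

(** The method is the primal-dual hybrid gradient method for the constraint
    [A *m v = A *m xs] in disguise, where [xs] is a solution. Write
    [residual k = A *m (x k - xs)] and [accum k = k *: (A *m (s k - xs))]. As
    [s k] is the mean of [x 1], ..., [x k], [accum k] is the sum of the first
    [k] residuals, and the gradient step at the extrapolated point is
    [lambda *: A^T *m (residual k + accum k)] ([momentum_gradE], [accumS]). So
    [accum] is, up to scaling, a dual variable, and half its squared length is
    [k ^ 2] times the gap [lsq (s k) - lsq_min].

    (i) The variational inequality of the proximal step at a solution, after
    polarization of the products of residuals, telescopes in [sqn (accum k)] and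
    in the squared distance to the solution ([descent]). Summation and
    convexity of [g] at the mean [s k] give the bound ([ergodic_bound]).

    (ii) Strong duality provides a saddle point ([strong_duality_kkt]). Relative
    to any saddle point, the squared distance of [(x k, accum k)] is
    nonincreasing, and its decrease controls the displacements ([fejer]). Hence
    [accum] is bounded, which is the [1 / k ^ 2] rate at [s]; squared
    displacements are summable and, by monotonicity of the subdifferential,
    nonincreasing, which is the [1 / k] rate at [x] ([speed_rate]). A limit
    point of the pairs is again a saddle point ([limit_kkt]), so by Opial's argument
    the whole sequence [x] converges ([iterates_cvg]), and the means [s] follow
    by Cesaro. The saddle inequality at [s k] bounds the values from below
    ([value_ge]).

    (iii) If [g] is bounded below, (i) forces the gap at [s k] to vanish and
    [g (s k)] to be asymptotically at most optimal, so that limit points are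
    solutions ([approx_solution_lim]). Bounded solution sets keep [s] bounded,
    by convexity ([penalized_bounded]); then a gap that is not [o(1/k)] would,
    through the penalty term, produce a feasible limit point with a value below
    the optimum ([penalized_gap_little]). *)

(** * Euclidean geometry *)

Section Vectors.
Context {R : realType}.

(** [sqn u] is [enorm u ^+ 2]; working with squared lengths keeps every
    estimate below polynomial in inner products. *)
Definition sqn {n} (u : 'cV[R]_n) : R := inner u u.

Lemma innerC {n} (u v : 'cV[R]_n) : inner u v = inner v u.
Proof. by apply: eq_bigr => i _; rewrite mulrC. Qed.

Lemma innerDl {n} (u v w : 'cV[R]_n) : inner (u + v) w = inner u w + inner v w.
Proof. by rewrite -big_split; apply: eq_bigr => i _; rewrite mxE mulrDl. Qed.

Lemma innerZl {n} a (u w : 'cV[R]_n) : inner (a *: u) w = a * inner u w.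
Proof. by rewrite mulr_sumr; apply: eq_bigr => i _; rewrite mxE mulrA. Qed.

Lemma innerNl {n} (u w : 'cV[R]_n) : inner (- u) w = - inner u w.
Proof. by rewrite -scaleN1r innerZl mulN1r. Qed.

Lemma innerBl {n} (u v w : 'cV[R]_n) : inner (u - v) w = inner u w - inner v w.
Proof. by rewrite innerDl innerNl. Qed.

Lemma innerDr {n} (u v w : 'cV[R]_n) : inner w (u + v) = inner w u + inner w v.
Proof. by rewrite innerC innerDl !(innerC w). Qed.

Lemma innerZr {n} a (u w : 'cV[R]_n) : inner w (a *: u) = a * inner w u.
Proof. by rewrite innerC innerZl innerC. Qed.

Lemma innerNr {n} (u w : 'cV[R]_n) : inner w (- u) = - inner w u.
Proof. by rewrite innerC innerNl innerC. Qed.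

Lemma innerBr {n} (u v w : 'cV[R]_n) : inner w (u - v) = inner w u - inner w v.
Proof. by rewrite innerDr innerNr. Qed.

Definition innerE := (@innerDl, @innerBl, @innerNl, @innerZl,
                      @innerDr, @innerBr, @innerNr, @innerZr).

Lemma inner0l {n} (w : 'cV[R]_n) : inner 0 w = 0.
Proof. by rewrite -(scale0r 0) innerZl mul0r. Qed.

Lemma inner0r {n} (w : 'cV[R]_n) : inner w 0 = 0.
Proof. by rewrite innerC inner0l. Qed.

Lemma inner_trmx {m n} (A : 'M[R]_(m, n)) u v :
  inner (A^T *m u) v = inner u (A *m v).
Proof.
rewrite /inner; under eq_bigr do rewrite mxE mulr_suml.
rewrite exchange_big; apply: eq_bigr => j _; rewrite mxE mulr_sumr.
by apply: eq_bigr => i _; rewrite mxE mulrCA mulrA.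
Qed.

Lemma sqn_ge0 {n} (u : 'cV[R]_n) : 0 <= sqn u.
Proof. by apply: sumr_ge0 => i _; rewrite -expr2 sqr_ge0. Qed.

Lemma sqr_coord_le_sqn {n} (u : 'cV[R]_n) i : u i ord0 ^+ 2 <= sqn u.
Proof.
rewrite /sqn /inner (bigD1 i)//= -expr2 lerDl.
by apply: sumr_ge0 => j _; rewrite -expr2 sqr_ge0.
Qed.

Lemma sqn_eq0 {n} (u : 'cV[R]_n) : sqn u <= 0 -> u = 0.
Proof.
move=> u0; apply/colP => i; rewrite mxE; apply/eqP; rewrite -sqrf_eq0 eq_le.
by rewrite sqr_ge0 (le_trans (sqr_coord_le_sqn u i)).
Qed.

Lemma sqn0 {n} : sqn (0 : 'cV[R]_n) = 0.
Proof. exact: inner0l. Qed.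

Lemma sqnZ {n} a (u : 'cV[R]_n) : sqn (a *: u) = a ^+ 2 * sqn u.
Proof. by rewrite /sqn !innerE mulrA -expr2. Qed.

Lemma sqnB {n} (u v : 'cV[R]_n) : sqn (u - v) = sqn u + sqn v - 2 * inner u v.
Proof. by rewrite /sqn !innerE (innerC v u); ring. Qed.

Lemma sqnD {n} (u v : 'cV[R]_n) : sqn (u + v) = sqn u + sqn v + 2 * inner u v.
Proof. by rewrite /sqn !innerE (innerC v u); ring. Qed.

Lemma sqr_enorm {n} (u : 'cV[R]_n) : enorm u ^+ 2 = sqn u.
Proof. by rewrite sqr_sqrtr// sqn_ge0. Qed.

(** Expand the squared length of [sqn u *: v - inner u v *: u], which is
    [sqn u * (sqn u * sqn v - inner u v ^+ 2)]. *)
Lemma CauchySchwarz_inner {n} (u v : 'cV[R]_n) :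
  inner u v ^+ 2 <= sqn u * sqn v.
Proof.
have [u0|u0] := leP (sqn u) 0.
  by rewrite (sqn_eq0 u0) sqn0 mul0r inner0l expr0n.
have := sqn_ge0 (sqn u *: v - inner u v *: u).
rewrite sqnB !sqnZ !innerE (innerC v u) => h.
rewrite -subr_ge0 -(pmulr_rge0 _ u0).
by apply: le_trans h _; rewrite le_eqVlt; apply/orP; left; apply/eqP; ring.
Qed.

(** [opnorm] is a [sup], which says something only for a bounded set: the
    Frobenius norm bounds this one, by Cauchy-Schwarz on each row. *)
Lemma opnorm_has_sup {m n} (A : 'M[R]_(m, n)) :
  has_sup [set enorm (A *m x) | x in [set x : 'cV[R]_n | enorm x <= 1]].
Proof.
split.
  by exists (enorm (A *m 0)), 0; rewrite //= /enorm [inner _ _]sqn0 sqrtr0.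
exists (Num.sqrt (\sum_i sqn (col i A^T))) => _ [x /= x1 <-].
rewrite ler_sqrt ?sumr_ge0// => [|i _]; last exact: sqn_ge0.
apply: ler_sum => i _; rewrite -expr2.
have -> : (A *m x) i ord0 = inner (col i A^T) x.
  by rewrite mxE; apply: eq_bigr => j _; rewrite !mxE.
apply: le_trans (CauchySchwarz_inner _ _) _.
rewrite ler_piMr ?sqn_ge0// -sqr_enorm expr_le1//.
exact: sqrtr_ge0.
Qed.

Lemma sqn_mulmx_le {m n} (A : 'M[R]_(m, n)) (d : 'cV[R]_n) :
  sqn (A *m d) <= opnorm A ^+ 2 * sqn d.
Proof.
have [d0|d0] := leP (sqn d) 0.
  by rewrite (sqn_eq0 d0) mulmx0 !sqn0 mulr0.
have e0 : 0 < enorm d by rewrite sqrtr_gt0.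
have : enorm (A *m ((enorm d)^-1 *: d)) <= opnorm A.
  apply: ub_le_sup; first by case: (opnorm_has_sup A).
  exists ((enorm d)^-1 *: d) => //=.
  rewrite -(@ler_pXn2r _ 2)// ?nnegrE ?sqrtr_ge0// sqr_enorm sqnZ -sqr_enorm.
  by rewrite exprVn mulVf ?expr1n// expf_eq0/= gt_eqF.
have op0 : 0 <= opnorm A.
  apply: le_trans (ub_le_sup _ _); last 2 first.
  - by case: (opnorm_has_sup A).
  - exists 0; last reflexivity.
    by rewrite /= /enorm [inner _ _]sqn0 sqrtr0.
  by rewrite sqrtr_ge0.
rewrite -(@ler_pXn2r _ 2)// ?nnegrE ?sqrtr_ge0// sqr_enorm -scalemxAr sqnZ.
by rewrite exprVn sqr_enorm [X in X <= _ -> _]mulrC ler_pdivrMr.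
Qed.

End Vectors.

(** * Limits along filters *)

Section Limits.
Context {R : realType} {T : Type}.
Implicit Types F : set_system T.

Lemma cvg_colP {n} F {FF : Filter F} (u : T -> 'cV[R]_n) (p : 'cV[R]_n) :
  u t @[t --> F] --> p <->
  forall i, (u t i ord0 : R) @[t --> F] --> (p i ord0 : R).
Proof.
split=> [up i|up V [P Pp PV]].
  exact: (@cvg_comp _ _ _ u (fun M : 'cV[R]_n => M i ord0) _ _ _ up
    (@coord_continuous R n 1 i ord0 p)).
have : \forall t \near F, forall i, P i ord0 (u t i ord0).
  have : forall r : seq 'I_n,
      \forall t \near F, forall i, i \in r -> P i ord0 (u t i ord0).
    elim=> [|j r IH]; first by apply: nearW.
    have uj : \forall t \near F, P j ord0 (u t j ord0) := up j _ (Pp j ord0).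
    apply: filterS2 uj IH => t Pj Pr i; rewrite inE => /predU1P[->//|].
    exact: Pr.
  by move/(_ (enum 'I_n)); apply: filterS => t h i; apply: h; rewrite mem_enum.
by apply: filterS => t ht; apply: PV => i j; rewrite (ord1 j).
Qed.

Lemma cvg_inner {n} F {FF : Filter F} (u v : T -> 'cV[R]_n) p q :
  u t @[t --> F] --> p -> v t @[t --> F] --> q ->
  inner (u t) (v t) @[t --> F] --> inner p q.
Proof.
move=> /cvg_colP up /cvg_colP vq.
apply: (@cvg_big R^o _ _ _ _ add_continuous) => i _.
by apply: cvgM; [exact: up|exact: vq].
Qed.

Lemma cvg_mulmxl {m n} F {FF : Filter F} (A : 'M[R]_(m, n))
    (u : T -> 'cV[R]_n) p :
  u t @[t --> F] --> p -> A *m u t @[t --> F] --> A *m p.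
Proof.
move=> /cvg_colP up; apply/cvg_colP => i; rewrite mxE.
under eq_cvg do rewrite mxE.
apply: (@cvg_big R^o _ _ _ _ add_continuous) => j _.
by apply: cvgM; [exact: cvg_cst|exact: up].
Qed.

Lemma cvg_sqn {n} F {FF : Filter F} (u : T -> 'cV[R]_n) p :
  sqn (u t - p) @[t --> F] --> 0 -> u t @[t --> F] --> p.
Proof.
move=> up; apply/cvg_colP => i; apply/cvgrPdist_lt => e e0.
have e20 : 0 < e ^+ 2 by rewrite exprn_gt0.
move/cvgrPdist_lt : up => /(_ _ e20); apply: filterS => t.
rewrite sub0r normrN ger0_norm ?sqn_ge0// => ute.
rewrite -(@ltr_pXn2r _ 2)// ?nnegrE ?(ltW e0)// real_normK ?num_real//.
apply: le_lt_trans ute; have := sqr_coord_le_sqn (u t - p) i.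
by rewrite !mxE -sqrrN opprB.
Qed.

(** An ultrafilter contains each set or its complement, a property that
    passes to images. *)
Lemma ultra_fmap {U : Type} F {UF : UltraFilter F} (f : T -> U) :
  UltraFilter (f @ F).
Proof.
have PF : ProperFilter F by exact: ultra_proper.
split; first exact: fmap_proper_filter.
move=> G PG fFG; rewrite predeqE => A; split; last exact: fFG.
move=> GA; have [//|FA] := in_ultra_setVsetC (f @^-1` A) UF.
have GnA : G (~` A) by apply: fFG.
by have [x [Ax /(_ Ax)]] := filter_ex (filterI GA GnA).
Qed.

(** Compactness of bounded sets in the form used throughout: along an
    ultrafilter no subsequence has to be extracted, so that two sequences such
    as the iterates and the accumulated residuals converge simultaneously. *)
Lemma bounded_ultra_cvg {n} F {UF : UltraFilter F} (u : T -> 'cV[R]_n)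
    (c : 'cV[R]_n) M :
  (\forall t \near F, sqn (u t - c) <= M) ->
  exists p : 'cV[R]_n, u t @[t --> F] --> p.
Proof.
move=> uM.
have PF : ProperFilter F by exact: ultra_proper.
suff /choice[p up] : forall i, exists p : R, (u t i ord0 : R) @[t --> F] --> p.
  by exists (\col_i p i); apply/cvg_colP => i; rewrite mxE; exact: up.
move=> i.
have := @segment_compact R (c i ord0 - (M + 1)) (c i ord0 + (M + 1)).
rewrite compact_ultra /=.
move=> /(_ ((fun t => u t i ord0 : R) @ F) (ultra_fmap _)) cpt.
suff /cpt[p [_ cp]] : F ((fun t => u t i ord0) @^-1`
    `[c i ord0 - (M + 1), c i ord0 + (M + 1)]) by exists p.
have M0 t : sqn (u t - c) <= M -> 0 <= M by apply: le_trans; exact: sqn_ge0.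
apply: filterS uM => t /= ut; have {}M0 := M0 t ut.
rewrite /= in_itv /= -ler_distlC -(@ler_pXn2r _ 2)// ?nnegrE ?addr_ge0//.
rewrite real_normK ?num_real//.
have := sqr_coord_le_sqn (u t - c) i; rewrite !mxE -sqrrN opprB => h.
apply: le_trans h _; apply: le_trans ut _; nra.
Qed.

Lemma lsc_le_lim {n} F {PF : ProperFilter F} (g : 'cV[R]_n -> \bar R)
    (u : T -> 'cV[R]_n) (r : T -> R) p rho :
  lower_semicontinuous g ->
  u t @[t --> F] --> p -> r t @[t --> F] --> rho ->
  (\forall t \near F, (g (u t) <= (r t)%:E)%E) -> (g p <= rho%:E)%E.
Proof.
move=> glsc up rrho gur; rewrite leNgt; apply/negP => rhog.
have [a rhoa ag] : exists2 a, rho < a & (a%:E < g p)%E.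
  case: (g p) rhog => [x| |//]; rewrite ?lte_fin => h.
    by exists ((rho + x) / 2); rewrite ?lte_fin; lra.
  by exists (rho + 1); rewrite ?ltry// ltrDl.
have [V Vp aV] := glsc _ _ ag.
have Vu : \forall t \near F, V (u t) := up V Vp.
have ra : \forall t \near F, r t < a by apply: cvgr_lt rrho _ rhoa.
have [t [[/= Vt gt] rt]] := filter_ex (filterI (filterI Vu gur) ra).
have := lt_le_trans (aV _ Vt) gt.
by rewrite lte_fin ltNge (ltW rt).
Qed.

End Limits.

(** If [P] failed to hold near [F], some ultrafilter finer than [F] would
    contain its complement. With [bounded_ultra_cvg] this is how a statement about all
    large [k] is reduced to one about a single limit point. *)
Lemma ultra_near {T : Type} (F : set_system T) {FF : Filter F} (P : set T) :
  (forall U, UltraFilter U -> F `<=` U -> U P) -> F P.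
Proof.
move=> FP; apply: contrapT => nFP.
have PG : ProperFilter (within (~` P) F).
  split; last exact: within_filter.
  rewrite /within /= => h; apply: nFP; apply: filterS h => t /= h.
  exact: contrapT.
have [U [UU GU]] := @ultraFilterLemma _ _ PG.
have UP : U P.
  by apply: FP => // B FB; apply: GU; rewrite /within /=; apply: filterS FB.
have UnP : U (~` P) by apply: GU; rewrite /within /=; apply: filterE.
by have [t [Pt /(_ Pt)]] := filter_ex (filterI UP UnP).
Qed.

Lemma near_div_le {R : realType} (K e : R) :
  0 < e -> \forall k \near \oo, K / k%:R <= e.
Proof.
move=> e0; near=> k.
have k0 : 0 < k%:R :> R by rewrite ltr0n; near: k; exact: nbhs_infty_gt.
rewrite ler_pdivrMr// -ler_pdivrMl//.
near: k; exact: nbhs_infty_ger.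
Unshelve. all: by end_near. Qed.

(** The recursion makes [s k] the mean of [x 1], ..., [x k]; [x 0] drops out
    because [s 0] is weighted by [0]. *)
Lemma cesaro_col {R : realType} {n} (x s : nat -> 'cV[R]_n) (p : 'cV[R]_n) :
  (forall k, s k.+1 = (k.+1%:R)^-1 *: (x k.+1 + k%:R *: s k)) ->
  x k @[k --> \oo] --> p -> s k @[k --> \oo] --> p.
Proof.
move=> sE /cvg_colP xp; apply/cvg_colP => i.
rewrite -cvg_shiftS /=.
have xi : ((fun k => x k.+1 i ord0 : R) @ \oo) --> (p i ord0 : R).
  by rewrite (cvg_shiftS (fun k => x k i ord0 : R)); exact: xp.
have := cesaro xi.
rewrite (_ : arithmetic_mean _ = fun k => s k.+1 i ord0 : R)//.
apply/funext => k /=.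
apply/esym/(mulfI (x := k.+1%:R)); first by rewrite pnatr_eq0.
rewrite mulrA divff ?pnatr_eq0// mul1r.
elim: k => [|k IH].
  by rewrite sE mul1r invr1 scale1r scale0r addr0 seriesEnat /= big_nat1.
by rewrite seriesSr -IH sE !mxE mulVKf ?pnatr_eq0// addrC.
Qed.

(** * The least-squares objective *)

(** First-order optimality on a segment: for small [t] the linear term wins. *)
Lemma slope_ge0 {R : realType} (a c : R) :
  (forall t, 0 < t < 1 -> 0 <= t * a + t ^+ 2 * c) -> 0 <= a.
Proof.
move=> h; rewrite leNgt; apply/negP => a0.
have d0 : 0 < `|c| - a + 1 by rewrite ltr_wpDl// subr_ge0 (le_trans (ltW a0)).
(* A step in the unit interval at which [t * `|c|] is still less than [- a]. *)
have := h (- a / (`|c| - a + 1)).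
set t := _ / _ => ht.
have t0 : 0 < t by rewrite divr_gt0// oppr_gt0.
have tE : t * (`|c| - a + 1) = - a by rewrite divfK// gt_eqF.
have t1 : t < 1 by rewrite ltr_pdivrMr// mul1r; have := normr_ge0 c; lra.
have := ht _; rewrite t0 t1 => /(_ isT).
rewrite expr2 -mulrA -mulrDr pmulr_rge0// => h2.
have : t * c <= t * `|c| by rewrite ler_pM2l// ler_norm.
nra.
Qed.

Section LeastSquares.
Context {R : realType} {m n : nat} (A : 'M[R]_(m, n)) (b : 'cV[R]_m).

Lemma lsq_expand (x d : 'cV[R]_n) :
  lsq A b (x + d) =
  lsq A b x + inner (grad_lsq A b x) d + 2^-1 * sqn (A *m d).
Proof.
rewrite /lsq /grad_lsq !sqr_enorm inner_trmx mulmxDr addrAC sqnD; lra.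
Qed.

Lemma grad_lsqD (x d : 'cV[R]_n) :
  grad_lsq A b (x + d) = grad_lsq A b x + A^T *m (A *m d).
Proof.
by rewrite /grad_lsq [A *m _]mulmxDr addrAC [LHS]mulmxDr.
Qed.

Lemma argmin_lsqP x : argmin_lsq A b x <-> grad_lsq A b x = 0.
Proof.
split=> [[_ _ xmin]|x0]; last first.
  split=> [//||y _]; first by rewrite /= ltry.
  rewrite lee_fin -(subrKC x y) lsq_expand x0 inner0l.
  have := sqn_ge0 (A *m (y - x)); lra.
apply: sqn_eq0; rewrite -oppr_ge0 -innerNr; apply: slope_ge0.
move=> t _; have := xmin (x + t *: (- grad_lsq A b x)) I.
rewrite lee_fin lsq_expand innerZr -scalemxAr sqnZ mulrCA -!addrA lerDl.
exact.
Qed.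

Lemma lsq_minE xb : argmin_lsq A b xb -> lsq_min A b = lsq A b xb.
Proof.
move=> [_ _ xmin]; apply/eqP; rewrite eq_le; apply/andP; split.
  apply: ge_inf; last by exists xb.
  exists (lsq A b xb) => _ [y _ <-].
  by have := xmin y I; rewrite lee_fin.
apply: lb_le_inf; first by exists (lsq A b xb), xb.
by move=> _ [y _ <-]; have := xmin y I; rewrite lee_fin.
Qed.

Definition gap x := lsq A b x - lsq_min A b.

Lemma gapE xb x : argmin_lsq A b xb ->
  gap x = 2^-1 * sqn (A *m (x - xb)).
Proof.
move=> xbmin; rewrite /gap (lsq_minE xbmin) -{1}(subrKC xb x) lsq_expand.
move/argmin_lsqP : xbmin => ->; rewrite inner0l; lra.
Qed.

Lemma gap_ge0 xb x : argmin_lsq A b xb -> 0 <= gap x.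
Proof. by move=> xbmin; rewrite (gapE _ xbmin) mulr_ge0 ?sqn_ge0. Qed.

(** Minimality is a vanishing gap, so by [gapE] the minimizers form a coset of
    the kernel of [A]. *)
Lemma argmin_lsqB xb x : argmin_lsq A b xb ->
  argmin_lsq A b x <-> A *m (x - xb) = 0.
Proof.
move=> xbmin; split=> [xmin|Axb].
  apply: sqn_eq0; have := gapE x xbmin; rewrite /gap (lsq_minE xmin) subrr.
  by move/eqP; rewrite eq_sym mulf_eq0 invr_eq0 pnatr_eq0/= => /eqP ->.
apply/argmin_lsqP; move/argmin_lsqP : xbmin.
rewrite /grad_lsq; suff -> : A *m x = A *m xb by [].
by apply/eqP; rewrite -subr_eq0 -mulmxBr Axb.
Qed.

Lemma mulmx_argminB xb y v : argmin_lsq A b xb -> argmin_lsq A b y ->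
  A *m (v - y) = A *m (v - xb).
Proof.
move=> xbmin /(argmin_lsqB _ xbmin) Ay.
by rewrite -[v - y](subrKA xb) mulmxDr -[xb - y]opprB mulmxN Ay subr0.
Qed.

End LeastSquares.

(** * Convex functions and the proximal step *)

Section ConvexFunctions.
Context {R : realType} {n : nat} (g : 'cV[R]_n -> \bar R).
Context (g_proper : proper_fun g) (g_convex : econvex g).

Lemma proper_fin_num x : (g x < +oo)%E -> g x \is a fin_num.
Proof.
by case: g_proper => gNoo _ gx; rewrite fin_numE gNoo lt_eqF.
Qed.

Lemma proper_le_fin x (r : R) : (g x <= r%:E)%E ->
  g x \is a fin_num /\ fine (g x) <= r.
Proof.
move=> h; have gx : g x \is a fin_num.
  by apply: proper_fin_num; apply: le_lt_trans h (ltry _).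
by split=> //; rewrite -lee_fin fineK.
Qed.

Lemma econvex_fine x y t : 0 < t < 1 ->
  g x \is a fin_num -> g y \is a fin_num ->
  g (t *: x + (1 - t) *: y) \is a fin_num /\
  fine (g (t *: x + (1 - t) *: y)) <= t * fine (g x) + (1 - t) * fine (g y).
Proof.
move=> t01 gx gy; apply: proper_le_fin.
have h := g_convex x y t01.
by rewrite -(fineK gx) -(fineK gy) -!EFinM -EFinD in h.
Qed.

(** The inclusion of [z - p] in the subdifferential of [tau g] at [p], obtained
    without subdifferentials: compare [p] with the points of the segment from
    [p] to [y], where convexity bounds [g], and let the step go to [0]. *)
Lemma prox_variational tau z p y : 0 < tau -> prox tau g z p ->
  g y \is a fin_num ->
  g p \is a fin_num /\ tau * (fine (g p) - fine (g y)) <= inner (p - z) (y - p).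
Proof.
move=> tau0 [_ poo pmin] gy.
have gp : g p \is a fin_num.
  apply: proper_fin_num; rewrite ltey; apply: contraTneq poo => ->.
  by rewrite gt0_muley ?lte_fin// addye// ltxx.
split=> //; rewrite -subr_ge0.
apply: (@slope_ge0 _ _ (2^-1 * sqn (y - p))) => t t01.
have [gq gqle] := econvex_fine t01 gy gp.
have := pmin (t *: y + (1 - t) *: p) I.
rewrite -(fineK gp) -(fineK gq) -!EFinM -!EFinD lee_fin !sqr_enorm.
have -> : t *: y + (1 - t) *: p - z = (p - z) + t *: (y - p).
  by apply/colP => i; rewrite !mxE; ring.
rewrite [sqn (_ + _ *: _)]sqnD sqnZ innerZr => h.
have h2 := ler_wpM2l (ltW tau0) gqle.
nra.
Qed.

End ConvexFunctions.

(** * Solutions and dual multipliers *)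

Section Multipliers.
Context {R : realType} {m n : nat} (g : 'cV[R]_n -> \bar R).
Context (A : 'M[R]_(m, n)) (b : 'cV[R]_m) (g_proper : proper_fun g).
Context (tau lambda : R) (tau_gt0 : 0 < tau) (lambda_gt0 : 0 < lambda).

(** A saddle point for the constraint [A *m v = A *m y], whose multiplier lives
    in the range space of [A]. The multiplier is [(lambda / tau) *: q]; with
    this scaling the limit points of the accumulated residuals are such [q]. *)
Definition kkt_pair (y : 'cV[R]_n) (q : 'cV[R]_m) :=
  [/\ argmin_lsq A b y, g y \is a fin_num &
   forall v, g v \is a fin_num ->
    0 <= tau * (fine (g v) - fine (g y)) + lambda * inner q (A *m (v - y))].

Lemma kkt_solution y q : kkt_pair y q -> solutions g A b y.
Proof.
move=> [ymin gy yq]; split=> //; first by rewrite ltey_eq gy.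
move=> v vmin; have [gv|] := boolP (g v \is a fin_num); last first.
  rewrite fin_numE negb_and !negbK; case: (g_proper) => gNoo _.
  by rewrite (negPf (gNoo v))/= => /eqP ->; rewrite leey.
have := yq _ gv; move/(argmin_lsqB _ ymin) : vmin => ->.
rewrite inner0r mulr0 addr0 pmulr_rge0// subr_ge0.
by rewrite -lee_fin !fineK.
Qed.

(** A multiplier [u] of the normal equations gives the multiplier [A *m u]. The
    saddle inequality in the dual variable, tested at [u + grad_lsq A b y],
    forces the primal point to minimize the least-squares objective. *)
Lemma strong_duality_kkt : strong_duality g A b -> exists y q, kkt_pair y q.
Proof.
move=> [y [u saddle]].
have gradE v : A^T *m A *m v - A^T *m b = grad_lsq A b v.
  by rewrite /grad_lsq mulmxBr mulmxA.
have gy : g y \is a fin_num.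
  apply: proper_fin_num => //; case: (g_proper) => _ [v]; rewrite -ltey => gv.
  have [_] := saddle v u; rewrite /lagrangian !gradE.
  move=> /le_lt_trans /(_ (lte_add_pinfty gv (ltry _))).
  by case: (g y) => //= r _; rewrite ltry.
have ymin : grad_lsq A b y = 0.
  apply: sqn_eq0; have [+ _] := saddle y (u + grad_lsq A b y).
  rewrite /lagrangian !gradE -(fineK gy) -!EFinD lee_fin innerDl -/(sqn _).
  lra.
exists y, ((tau / lambda) *: (A *m u)); split=> //; first exact/argmin_lsqP.
move=> v gv; have [_] := saddle v u.
rewrite /lagrangian !gradE -{2}(subrKC y v) grad_lsqD ymin add0r.
rewrite -(fineK gy) -(fineK gv) -!EFinD lee_fin -(ler_pM2l tau_gt0).
rewrite inner0r (innerC u) inner_trmx (innerC _ (A *m u)) innerZl.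
have -> : lambda * (tau / lambda * inner (A *m u) (A *m (v - y))) =
   tau * inner (A *m u) (A *m (v - y)) by field; rewrite gt_eqF.
lra.
Qed.

End Multipliers.

(** * The iteration as a primal-dual method *)

Section Iterates.
Context {R : realType} {m n : nat} (g : 'cV[R]_n -> \bar R).
Context (A : 'M[R]_(m, n)) (b : 'cV[R]_m).
Context (g_proper : proper_fun g) (g_convex : econvex g)
  (g_lsc : lower_semicontinuous g).
Context (tau lambda : R) (tau_gt0 : 0 < tau) (lambda_gt0 : 0 < lambda)
  (step : lambda * opnorm A ^+ 2 < 1).
Context (x s : nat -> 'cV[R]_n) (xb : 'cV[R]_n) (xb_min : argmin_lsq A b xb).

Local Notation kkt := (kkt_pair g A b tau lambda).
Local Notation gap := (gap A b).

Definition residual k := A *m (x k - xb).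

(** The sum of the residuals of [x 1], ..., [x k] by [accumS]; up to the factor
    [lambda / tau] it is the dual variable of the primal-dual method. *)
Definition accum k := k%:R *: (A *m (s k - xb)).

(** The long step at the extrapolated point is a step of the primal-dual hybrid
    gradient method: [accum k] is the dual variable and the extra [residual k]
    its extrapolation. *)
Lemma momentum_gradE k :
  (k.+1%:R * lambda) *:
    grad_lsq A b ((k.+1%:R)^-1 *: (x k + k%:R *: s k)) =
  lambda *: (A^T *m (residual k + accum k)).
Proof.
have -> : (k.+1%:R)^-1 *: (x k + k%:R *: s k) =
    xb + (k.+1%:R)^-1 *: ((x k - xb) + k%:R *: (s k - xb)).
  apply/colP => i; rewrite !mxE; field.
  by rewrite nat1r pnatr_eq0.
rewrite grad_lsqD; move/argmin_lsqP : xb_min => ->; rewrite add0r.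
rewrite -!scalemxAr scalerA mulrAC divff ?pnatr_eq0// mul1r.
by rewrite [A *m _]mulmxDr -scalemxAr.
Qed.

Lemma residualS k : residual k.+1 = residual k + A *m (x k.+1 - x k).
Proof. by rewrite /residual -mulmxDr [in RHS]addrC subrKA. Qed.

Context (sE : forall k, s k.+1 = (k.+1%:R)^-1 *: (x k.+1 + k%:R *: s k)).
Context (xE : forall k,
  prox tau g (x k - lambda *: (A^T *m (residual k + accum k))) (x k.+1)).

Lemma accumS k : accum k.+1 = accum k + residual k.+1.
Proof.
rewrite /accum /residual !scalemxAr -mulmxDr sE; congr (A *m _).
apply/colP => i; rewrite !mxE; field.
by rewrite nat1r pnatr_eq0.
Qed.

Lemma accum0 : accum 0 = 0.
Proof. by rewrite /accum scale0r. Qed.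

Lemma fin_num_x k : g (x k.+1) \is a fin_num.
Proof.
case: (g_proper) => _ [y]; rewrite -ltey => /(proper_fin_num g_proper) gy.
by have [] := prox_variational g_proper g_convex tau_gt0 (xE k) gy.
Qed.

Arguments fin_num_x : clear implicits.

(** At [k = 0] the possibly infinite value [g (s 0)] has weight [0]. *)
Lemma ergodic_jensen k : g (s k.+1) \is a fin_num /\
  k.+1%:R * fine (g (s k.+1)) <= fine (g (x k.+1)) + k%:R * fine (g (s k)).
Proof.
elim: k => [|k [gs _]].
  rewrite sE scale0r addr0 invr1 scale1r mul1r mul0r addr0.
  by split; [exact: fin_num_x|].
have k0 : k.+2%:R != 0 :> R by rewrite pnatr_eq0.
have t01 : 0 < (k.+2%:R^-1 : R) < 1.
  by rewrite invr_gt0 ltr0n/= invf_lt1 ?ltr0n// ltr1n.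
have tE : 1 - k.+2%:R^-1 = k.+2%:R^-1 * k.+1%:R :> R.
  by rewrite -[k.+2]addn1 natrD; field; rewrite -natr1 in k0.
have [] := econvex_fine g_proper g_convex t01 (fin_num_x k.+1) gs.
rewrite tE -scalerA -scalerDr -sE => gs2 le2; split=> //.
rewrite -(@ler_pM2l _ k.+2%:R^-1) ?invr_gt0 ?ltr0n// mulKf//.
by rewrite mulrDr mulrA.
Qed.

Lemma step_variational k y : g y \is a fin_num ->
  tau * (fine (g (x k.+1)) - fine (g y)) <=
  inner (x k.+1 - x k) (y - x k.+1) +
  lambda * inner (residual k + accum k) (A *m (y - x k.+1)).
Proof.
move=> gy.
have [_] := prox_variational g_proper g_convex tau_gt0 (xE k) gy.
by rewrite opprB addrCA [inner (_ *: _ + _) _]innerDl innerZl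
  inner_trmx [X in _ <= X -> _]addrC.
Qed.

Let c := 1 - lambda * opnorm A ^+ 2.

Lemma step_gap_gt0 : 0 < c. Proof. by rewrite subr_gt0. Qed.

Lemma lambda_sqn_mulmx d : lambda * sqn (A *m d) <= (1 - c) * sqn d.
Proof.
rewrite /c subKr -mulrA ler_pM2l//; exact: sqn_mulmx_le.
Qed.

(** Apply [step_variational] at a minimizer [y] of the least-squares objective.
    The product of [residual k + accum k] with [residual k.+1] polarizes into a
    telescoping difference of [sqn (accum _)], plus [sqn (residual k)], minus
    [sqn (residual k.+1 - residual k)]; the step-size condition lets the
    squared displacement absorb the last one. *)
Lemma descent k (y : 'cV[R]_n) : A *m (y - xb) = 0 -> g y \is a fin_num ->
  2 * tau * (fine (g (x k.+1)) - fine (g y)) +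
  lambda * (sqn (accum k.+1) - sqn (accum k) + sqn (residual k)) +
  c * sqn (x k.+1 - x k) + sqn (x k.+1 - y) <= sqn (x k - y).
Proof.
move=> Ayxb gy; have := step_variational k gy.
have -> : A *m (y - x k.+1) = - residual k.+1.
  by rewrite -[y - _](subrKA xb) mulmxDr Ayxb add0r /residual -mulmxN opprB.
have := lambda_sqn_mulmx (x k.+1 - x k).
have -> : x k - y = (x k.+1 - y) - (x k.+1 - x k).
  by apply/colP => i; rewrite !mxE; ring.
rewrite accumS residualS.
set d := x k.+1 - x k; set a := A *m d; set e := residual k; set E := accum k.
rewrite -[y - _]opprB; set w := x k.+1 - y.
(* What remains is a polynomial inequality in inner products. *)
clearbody w d a e E.
rewrite [sqn (w - d)]sqnB !sqnD !innerE ?(innerC d w) ?(innerC a e) -!/(sqn _).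
lra.
Qed.

(** Sum [descent] over the iterations and use convexity at the means. *)
Lemma ergodic_bound k (y : 'cV[R]_n) : A *m (y - xb) = 0 -> g y \is a fin_num ->
  2 * tau * (k%:R * (fine (g (s k)) - fine (g y))) +
  lambda * sqn (accum k) + sqn (x k - y) <= sqn (x 0 - y).
Proof.
move=> Ay gy; elim: k => [|k IH].
  by rewrite mul0r mulr0 accum0 sqn0 mulr0 !add0r.
have [_ J] := ergodic_jensen k.
have D := descent k Ay gy.
have tJ : tau * (k.+1%:R * (fine (g (s k.+1)) - fine (g y))) <=
    tau * ((fine (g (x k.+1)) - fine (g y)) +
           k%:R * (fine (g (s k)) - fine (g y))).
  by rewrite ler_pM2l// -natr1 in J *; lra.
have c0 := step_gap_gt0.
have d0 := mulr_ge0 (ltW c0) (sqn_ge0 (x k.+1 - x k)).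
have r0 := mulr_ge0 (ltW lambda_gt0) (sqn_ge0 (residual k)).
lra.
Qed.

Lemma gap_x k : gap (x k) = 2^-1 * sqn (residual k).
Proof. exact: gapE. Qed.

Lemma gap_s k : k%:R ^+ 2 * gap (s k) = 2^-1 * sqn (accum k).
Proof. by rewrite (gapE _ xb_min) /accum sqnZ mulrCA. Qed.

(** [ergodic_bound] divided by [2 * tau * k]. *)
Lemma penalized_value_le k (y : 'cV[R]_n) : (0 < k)%N ->
  A *m (y - xb) = 0 -> g y \is a fin_num ->
  fine (g (s k)) + lambda / tau * k%:R * gap (s k) - fine (g y) <=
  sqn (x 0 - y) / (2 * tau) / k%:R.
Proof.
move=> k0 Ay gy; have kR : 0 < k%:R :> R by rewrite ltr0n.
have := ergodic_bound k Ay gy.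
have -> : sqn (accum k) = 2 * (k%:R ^+ 2 * gap (s k)) by rewrite gap_s; lra.
have := sqn_ge0 (x k - y).
rewrite ler_pdivlMr// ler_pdivlMr ?mulr_gt0// => ? ?.
have -> : (fine (g (s k)) + lambda / tau * k%:R * gap (s k) -
    fine (g y)) * k%:R * (2 * tau) =
   2 * tau * (k%:R * (fine (g (s k)) - fine (g y))) +
   lambda * (2 * (k%:R ^+ 2 * gap (s k))) by field; rewrite gt_eqF.
lra.
Qed.

Lemma kkt_residual y q k : kkt y q ->
  - (lambda * inner q (residual k.+1)) <=
  tau * (fine (g (x k.+1)) - fine (g y)).
Proof.
move=> [ymin gy yq]; have := yq _ (fin_num_x k).
by rewrite (mulmx_argminB _ xb_min ymin) -/(residual _); lra.
Qed.

(** The squared distance from the primal-dual iterate to [(y, q)]. *)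
Definition energy (y : 'cV[R]_n) (q : 'cV[R]_m) k :=
  sqn (x k - y) + lambda * sqn (accum k - q).

Lemma energy_ge0 y q k : 0 <= energy y q k.
Proof. by rewrite addr_ge0 ?mulr_ge0 ?sqn_ge0 1?ltW. Qed.

(** Fejer monotonicity: at a saddle point the loss of objective in [descent]
    is bounded below by a product with the multiplier, which completes the
    square in [accum _ - q]. *)
Lemma fejer y q k : kkt y q ->
  energy y q k.+1 + lambda * sqn (residual k) + c * sqn (x k.+1 - x k) <=
  energy y q k.
Proof.
move=> yq; have K := kkt_residual k yq; case: yq => ymin gy _.
move/(argmin_lsqB _ xb_min) : ymin => Ay.
have := descent k Ay gy; rewrite /energy accumS.
move: (residual k.+1) K => e; move: (accum k) (residual k) => E e0.
rewrite ![sqn (_ - q)]sqnB [inner (E + e) q]innerDl (innerC e q); lra.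
Qed.

Lemma energy_le y q j k : kkt y q -> (j <= k)%N -> energy y q k <= energy y q j.
Proof.
move=> yq /subnK <-; elim: (k - j)%N => // i; apply: le_trans.
have := fejer (i + j) yq; rewrite addSn.
have := mulr_ge0 (ltW step_gap_gt0) (sqn_ge0 (x (i + j).+1 - x (i + j)%N)).
have := mulr_ge0 (ltW lambda_gt0) (sqn_ge0 (residual (i + j))); lra.
Qed.

(** The squared displacement of the primal-dual iterate, since
    [accum k.+1 - accum k = residual k.+1]. *)
Definition speed k := sqn (x k.+1 - x k) + lambda * sqn (residual k.+1).

Lemma speed_ge0 k : 0 <= speed k.
Proof. by rewrite addr_ge0 ?mulr_ge0 ?sqn_ge0 1?ltW. Qed.

(** Each proximal step, tested at the point produced by the other, gives an
    inequality between consecutive displacements, in whose sum the values of [g]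
    cancel: this is monotonicity of the subdifferential. The step-size condition
    is used on the second difference of [x]. *)
Lemma speed_nonincreasing k : speed k.+1 <= speed k.
Proof.
have I1 := step_variational k (fin_num_x k.+1).
have I2 := step_variational k.+1 (fin_num_x k).
have L := lambda_sqn_mulmx ((x k.+2 - x k.+1) - (x k.+1 - x k)).
have c0 := mulr_ge0 (ltW step_gap_gt0)
  (sqn_ge0 ((x k.+2 - x k.+1) - (x k.+1 - x k))).
have a0 := mulr_ge0 (ltW lambda_gt0) (sqn_ge0 (A *m (x k.+1 - x k))).
rewrite /speed (residualS k.+1).
move: I1 I2 L c0 a0; rewrite accumS residualS.
rewrite -[x k.+1 - x k.+2]opprB mulmxN [A *m (_ - (_ - _))]mulmxBr.
move: (x k.+2 - x k.+1) (x k.+1 - x k) => d1 d0.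
move: (A *m d0) (A *m d1) (residual k) (accum k) => a0 a1 e E.
rewrite ![sqn (_ - _)]sqnB !sqnD !innerE.
rewrite ?(innerC d1 d0) ?(innerC a1 a0) ?(innerC a1 e) ?(innerC a0 e)
  ?(innerC _ E) -!/(sqn _).
lra.
Qed.

(** By [fejer] the [speed]s are summable, and a nonincreasing summable sequence
    is [O(1/k)]. *)
Lemma speed_rate y q k : kkt y q -> c * (k%:R * speed k) <= energy y q 0.
Proof.
move=> yq; have c0 := step_gap_gt0.
have c1 : c <= 1 by rewrite gerBl mulr_ge0 ?sqr_ge0 ?ltW.
have d0 j := mulr_ge0 (ltW c0) (sqn_ge0 (x j.+1 - x j)).
have r0 j := mulr_ge0 (ltW lambda_gt0) (sqn_ge0 (residual j)).
have F0 := fejer 0 yq.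
(* [fejer] bounds the residual at [k] and the displacement from [k], whereas
   [speed k] has the residual at [k.+1]; hence the extra displacement term in
   the induction invariant. *)
suff : energy y q k.+1 + c * sqn (x k.+1 - x k) + c * (k%:R * speed k) <=
    energy y q 1 + c * sqn (x 1 - x 0).
  by have := energy_ge0 y q k.+1; have := d0 k; have := r0 0; lra.
elim: k => [|k IH]; first by rewrite mul0r mulr0 addr0.
have V : c * (k.+1%:R * speed k.+1) <= c * (k.+1%:R * speed k).
  by rewrite ler_pM2l// ler_pM2l// speed_nonincreasing.
have F1 := fejer k.+1 yq.
have cr : c * (lambda * sqn (residual k.+1)) <= lambda * sqn (residual k.+1).
  by rewrite ler_piMl.
have VE : c * (k.+1%:R * speed k) = c * (k%:R * speed k) + c * speed k.
  by rewrite -natr1; ring.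
have : c * speed k =
    c * sqn (x k.+1 - x k) + c * (lambda * sqn (residual k.+1)).
  by rewrite mulrDr.
rewrite VE in V; lra.
Qed.

Lemma speed_cvg0 y q : kkt y q -> speed k @[k --> \oo] --> (0 : R).
Proof.
move=> yq; rewrite -cvg_shiftS.
apply: (@squeeze_cvgr _ _ _ _ (fun=> 0)
    (fun k => energy y q 0 / c * k.+1%:R^-1)).
- near=> k; rewrite speed_ge0/= ler_pdivlMr ?ltr0n//.
  rewrite ler_pdivlMr ?step_gap_gt0// mulrC [_ * k.+1%:R]mulrC.
  exact: speed_rate.
- exact: cvg_cst.
- rewrite -[0 in X in _ --> X](mulr0 (energy y q 0 / c)).
  by apply: cvgM; [exact: cvg_cst|exact: cvg_harmonic].
Unshelve. all: by end_near. Qed.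

Lemma displacement_cvg0 y q : kkt y q ->
  x k.+1 - x k @[k --> \oo] --> (0 : 'cV[R]_n).
Proof.
move=> yq; apply: cvg_sqn.
apply: (@squeeze_cvgr _ _ _ _ (fun=> 0) speed).
- near=> k; rewrite subr0 sqn_ge0/= lerDl mulr_ge0 ?sqn_ge0//; exact: ltW.
- exact: cvg_cst.
- exact: speed_cvg0 yq.
Unshelve. all: by end_near. Qed.

Lemma residual_cvg0 y q : kkt y q ->
  residual k.+1 @[k --> \oo] --> (0 : 'cV[R]_m).
Proof.
move=> yq; apply: cvg_sqn.
apply: (@squeeze_cvgr _ _ _ _ (fun=> 0) (fun k => lambda^-1 * speed k)).
- near=> k; rewrite subr0 sqn_ge0/= ler_pdivlMl// lerDr; exact: sqn_ge0.
- exact: cvg_cst.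
- rewrite -[0 in X in _ --> X](mulr0 lambda^-1).
  by apply: cvgM; [exact: cvg_cst|exact: speed_cvg0 yq].
Unshelve. all: by end_near. Qed.

(** Displacements and residuals vanish, so [step_variational] passes to the
    limit, by lower semicontinuity on its left-hand side, and becomes the
    saddle inequality. *)
Lemma limit_kkt F {PF : ProperFilter F} y q p r : \oo `<=` F -> kkt y q ->
  x k.+1 @[k --> F] --> p -> accum k.+1 @[k --> F] --> r -> kkt p r.
Proof.
move=> Foo yq xp Er.
have dF : x k.+1 - x k @[k --> F] --> (0 : 'cV[R]_n).
  apply: cvg_trans (displacement_cvg0 yq); exact: cvg_app Foo.
have rF : residual k.+1 @[k --> F] --> (0 : 'cV[R]_m).
  apply: cvg_trans (residual_cvg0 yq); exact: cvg_app Foo.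
have Ap : A *m (p - xb) = 0.
  apply: cvg_unique rF; first exact: norm_hausdorff.
  by apply: cvg_mulmxl; apply: cvgB xp _; exact: cvg_cst.
have lim v : g v \is a fin_num ->
    (g p <= (fine (g v) + lambda / tau * inner r (A *m (v - p)))%:E)%E.
  move=> gv; apply: (lsc_le_lim (r := fun k => fine (g v) +
    tau^-1 * (inner (x k.+1 - x k) (v - x k.+1) +
      lambda * inner (accum k.+1 - A *m (x k.+1 - x k))
                     (A *m (v - x k.+1)))) g_lsc xp).
    have -> : lambda / tau * inner r (A *m (v - p)) = tau^-1 *
        (inner 0 (v - p) + lambda * inner (r - A *m 0) (A *m (v - p))).
      by rewrite inner0l add0r mulmx0 subr0; ring.
    have vx : v - x k.+1 @[k --> F] --> v - p.
      by apply: cvgB xp; exact: cvg_cst.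
    apply: cvgD; first exact: cvg_cst.
    apply: cvgM; first exact: cvg_cst.
    apply: cvgD; first exact: cvg_inner.
    apply: cvgM; first exact: cvg_cst.
    apply: cvg_inner; last exact: cvg_mulmxl.
    by apply: cvgB => //; exact: cvg_mulmxl.
  near=> k.
  rewrite -(fineK (fin_num_x k)) lee_fin -lerBlDl ler_pdivlMl//.
  rewrite accumS residualS addrA addrK [accum k + _]addrC.
  exact: step_variational.
case: (yq) => _ gy _.
have [gp _] := proper_le_fin g_proper (lim _ gy).
split=> //; first by apply/(argmin_lsqB _ xb_min).
move=> v gv; have := lim _ gv; rewrite -(fineK gp) lee_fin -(ler_pM2l tau_gt0).
have -> : tau * (fine (g v) + lambda / tau * inner r (A *m (v - p))) =
    tau * fine (g v) + lambda * inner r (A *m (v - p)).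
  by field; rewrite gt_eqF.
lra.
Unshelve. all: by end_near. Qed.

(** Opial's argument: the energy relative to a limit point that is itself a
    saddle point is nonincreasing and tends to [0] along an ultrafilter, hence
    tends to [0]. *)
Lemma iterates_cvg y q : kkt y q ->
  exists (p : 'cV[R]_n) (r : 'cV[R]_m), kkt p r /\ x k @[k --> \oo] --> p.
Proof.
move=> yq.
have [U [UU Uoo]] := @ultraFilterLemma nat \oo _.
have PU : ProperFilter U by exact: ultra_proper.
have [p xp] : exists p : 'cV[R]_n, x k.+1 @[k --> U] --> p.
  apply: (@bounded_ultra_cvg _ _ _ _ _ _ y (energy y q 0)).
  near=> k; apply: le_trans (energy_le yq (leq0n k.+1)).
  by rewrite lerDl mulr_ge0 ?sqn_ge0// ltW.
have [r Er] : exists r : 'cV[R]_m, accum k.+1 @[k --> U] --> r.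
  apply: (@bounded_ultra_cvg _ _ _ _ _ _ q (lambda^-1 * energy y q 0)).
  near=> k; rewrite ler_pdivlMl//.
  apply: le_trans (energy_le yq (leq0n k.+1)).
  by rewrite lerDr sqn_ge0.
have pr : kkt p r by exact: limit_kkt Uoo yq xp Er.
exists p, r; split=> //.
suff : sqn (x k - p) @[k --> \oo] --> (0 : R) by exact: cvg_sqn.
apply/cvgrPdist_lt => e e0.
have eU : energy p r k.+1 @[k --> U] --> (0 : R).
  rewrite -[0](addr0 0) -[X in _ --> _ + X](mulr0 lambda).
  have sqn_cvg0 l (u : nat -> 'cV[R]_l) (z : 'cV[R]_l) : u k @[k --> U] --> z ->
      sqn (u k - z) @[k --> U] --> (0 : R).
    move=> uz; rewrite -(@sqn0 R l) -(subrr z).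
    have uzz : u k - z @[k --> U] --> z - z.
      by apply: cvgB => //; exact: cvg_cst.
    exact: cvg_inner.
  apply: cvgD; first exact: sqn_cvg0.
  by apply: cvgM; [exact: cvg_cst|exact: sqn_cvg0].
have [j /= je] := filter_ex (cvgr_lt _ eU _ e0).
exists j.+1 => // k /= jk.
rewrite sub0r normrN ger0_norm ?sqn_ge0//; apply: le_lt_trans je.
apply: le_trans (energy_le pr jk).
by rewrite lerDl mulr_ge0 ?sqn_ge0// ltW.
Unshelve. all: by end_near. Qed.

(** The index starts at [2] because [speed k.+1] bounds the residual at [k.+2]
    and its rate is [1 / k.+1]; the factor [2] turns this into [1 / k.+2]. *)
Lemma residual_rate y q k : kkt y q ->
  lambda * c * (k.+2%:R * sqn (residual k.+2)) <= 2 * energy y q 0.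
Proof.
move=> yq; have c0 := step_gap_gt0.
have := speed_rate k.+1 yq; have d0 := sqn_ge0 (x k.+2 - x k.+1).
have k2 : k.+2%:R <= 2 * k.+1%:R :> R.
  by rewrite -natrM ler_nat mul2n -addnn addSn ltnS leq_addl.
have r0 : 0 <= lambda * c * sqn (residual k.+2).
  by rewrite mulr_ge0 ?sqn_ge0// mulr_ge0// ltW.
have := ler_wpM2l r0 k2.
have : 0 <= c * (k.+1%:R * sqn (x k.+2 - x k.+1)).
  by rewrite !mulr_ge0 ?sqn_ge0 ?ler0n ?(ltW c0).
rewrite /speed; lra.
Qed.

Lemma accum_bounded y q k : kkt y q ->
  sqn (accum k) <= 2 * (energy y q 0 / lambda + sqn q).
Proof.
move=> yq; have := energy_le yq (leq0n k).
rewrite [energy y q k]/energy => h.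
have {h} : lambda * sqn (accum k - q) <= energy y q 0.
  by apply: le_trans h; rewrite lerDr sqn_ge0.
rewrite -ler_pdivlMl// mulrC.
(* The parallelogram inequality for [accum k = (accum k - q) + q]. *)
have := sqn_ge0 (accum k - 2 *: q).
rewrite !sqnB sqnZ innerZr; lra.
Qed.

(** Test the saddle inequality at [s k.+1], where [k.+1] times the constraint
    violation is [accum k.+1], and use Young's inequality. *)
Lemma value_ge y q k : kkt y q ->
  - (lambda * (2^-1 * (sqn q + sqn (accum k.+1)))) <=
  tau * (k.+1%:R * (fine (g (s k.+1)) - fine (g y))).
Proof.
case=> ymin gy yq; have [gs _] := ergodic_jensen k.
have := yq _ gs; rewrite (mulmx_argminB _ xb_min ymin).
rewrite -(ler_pM2l (ltr0Sn R k)) mulr0.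
have -> : k.+1%:R * (tau * (fine (g (s k.+1)) - fine (g y)) +
    lambda * inner q (A *m (s k.+1 - xb))) =
    tau * (k.+1%:R * (fine (g (s k.+1)) - fine (g y))) +
    lambda * inner q (accum k.+1) by rewrite /accum innerZr; ring.
have := mulr_ge0 (ltW lambda_gt0) (sqn_ge0 (q - accum k.+1)).
rewrite sqnB; lra.
Qed.

End Iterates.

(** * Sequences with bounded penalized values *)

Section Penalty.
Context {R : realType} {m n : nat} (g : 'cV[R]_n -> \bar R).
Context (A : 'M[R]_(m, n)) (b : 'cV[R]_m).
Context (g_proper : proper_fun g) (g_convex : econvex g)
  (g_lsc : lower_semicontinuous g).
Context (xs : 'cV[R]_n) (xs_sol : solutions g A b xs).

Local Notation gap := (gap A b).

Lemma solution_argmin : argmin_lsq A b xs. Proof. by case: xs_sol. Qed.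

Lemma solution_fin : g xs \is a fin_num.
Proof. by case: xs_sol => _ h _; exact: proper_fin_num. Qed.

Lemma solution_of_le p : argmin_lsq A b p -> (g p <= g xs)%E ->
  solutions g A b p.
Proof.
case: xs_sol => _ xs_oo xs_le pmin pxs; split=> //.
  exact: le_lt_trans pxs xs_oo.
by move=> y ymin; apply: le_trans pxs _; exact: xs_le.
Qed.

Lemma opt_valE : opt_val g A b = g xs.
Proof.
case: (xs_sol) => xs_min _ xs_le; apply/eqP; rewrite eq_le; apply/andP; split.
  by apply: ereal_inf_lbound; exists xs.
by apply: le_ereal_inf_tmp => _ [y ymin <-]; exact: xs_le.
Qed.

(** Stated for any filter because it serves both limits along an ultrafilter on
    the indices and cluster points, which are limits of filters on points. *)
Lemma approx_solution_lim {T : Type} (F : set_system T) {PF : ProperFilter F}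
    (u : T -> 'cV[R]_n) (p : 'cV[R]_n) (gamma : R) :
  u t @[t --> F] --> p ->
  (forall e, 0 < e -> \forall t \near F,
     (g (u t) <= (gamma + e)%:E)%E /\ gap (u t) <= e) ->
  argmin_lsq A b p /\ (g p <= gamma%:E)%E.
Proof.
move=> up uapprox; split; last first.
  apply/lee_addgt0Pr => e e0; rewrite -EFinD.
  apply: (lsc_le_lim (r := fun=> gamma + e) g_lsc up); first exact: cvg_cst.
  by apply: filterS (uapprox _ e0) => t [].
apply/(argmin_lsqB _ solution_argmin)/sqn_eq0.
have Aup : A *m (u t - xs) @[t --> F] --> A *m (p - xs).
  by apply: cvg_mulmxl; apply: cvgB => //; exact: cvg_cst.
apply/ler_addgt0Pr => e e0; rewrite add0r.
have sqAup : sqn (A *m (u t - xs)) @[t --> F] --> sqn (A *m (p - xs)).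
  exact: cvg_inner.
apply: (cvgr_to_le sqAup).
have e20 : 0 < 2^-1 * e by rewrite mulr_gt0.
apply: filterS (uapprox _ e20) => t [_].
by rewrite (gapE _ solution_argmin) ler_pM2l.
Qed.

Context (sigma C : R) (sigma_gt0 : 0 < sigma).
Context (s : nat -> 'cV[R]_n).
Context (s_pen : forall k, (0 < k)%N ->
  (g (s k) <= (fine (g xs) + C / k%:R - sigma * k%:R * gap (s k))%:E)%E).
Context (cst : R) (g_ge : forall v, (cst%:E <= g v)%E).

Lemma near_value_le e : 0 < e ->
  \forall k \near \oo, (g (s k) <= (fine (g xs) + e)%:E)%E.
Proof.
move=> e0; near=> k.
have k0 : (0 < k)%N by near: k; exact: nbhs_infty_gt.
apply: le_trans (s_pen k0) _; rewrite lee_fin.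
have : C / k%:R <= e by near: k; exact: near_div_le.
have : 0 <= sigma * k%:R * gap (s k).
  by rewrite mulr_ge0 ?(gap_ge0 _ solution_argmin)// mulr_ge0 ?ler0n// ltW.
lra.
Unshelve. all: by end_near. Qed.

Lemma near_gap_le e : 0 < e -> \forall k \near \oo, gap (s k) <= e.
Proof.
move=> e0; near=> k.
have k0 : (0 < k)%N by near: k; exact: nbhs_infty_gt.
have kR : 0 < k%:R :> R by rewrite ltr0n.
have := le_trans (g_ge _) (s_pen k0); rewrite lee_fin => h.
have k1 : C / k%:R <= 1 by near: k; exact: near_div_le.
have : (sigma^-1 * (fine (g xs) + 1 - cst)) / k%:R <= e.
  by near: k; exact: near_div_le.
apply: le_trans; rewrite ler_pdivlMr// ler_pdivlMl// [gap _ * _]mulrC mulrA.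
lra.
Unshelve. all: by end_near. Qed.

(** A lower bound on [g] turns the penalized estimate into a vanishing
    constraint violation. *)
Lemma cluster_solution : cluster (s k @[k --> \oo]) `<=` solutions g A b.
Proof.
move=> p; rewrite cluster_cvgE => -[G PG [Gp sG]].
have [pmin gp] : argmin_lsq A b p /\ (g p <= (fine (g xs))%:E)%E.
  apply: (@approx_solution_lim _ G _ id) => // e e0.
  apply: sG; apply: filterS2 (near_value_le e0) (near_gap_le e0).
  by move=> k.
by apply: solution_of_le => //; rewrite -(fineK solution_fin).
Qed.

Context (M : R) (S_bounded : forall y, solutions g A b y -> enorm y <= M).

(** If infinitely many [s k] were far from [xs], the points where the segments
    from [xs] to these [s k] cross a fixed sphere around [xs] would, by
    convexity, have a limit that is a solution on that sphere; the radius
    exceeds the distance from [xs] to every solution. *)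
Lemma penalized_bounded : exists r, \forall k \near \oo, sqn (s k - xs) <= r.
Proof.
have M0 : 0 <= M by apply: le_trans (S_bounded xs_sol); exact: sqrtr_ge0.
(* Two solutions are at distance at most [2 * M]. *)
pose r := 4 * M ^+ 2 + 1.
have r0 : 0 < r by rewrite /r ltr_wpDl// mulr_ge0// exprn_ge0.
have S_r y : solutions g A b y -> sqn (y - xs) < r.
  move=> ys; have yM : sqn y <= M ^+ 2.
    by rewrite -sqr_enorm ler_pXn2r ?nnegrE ?sqrtr_ge0// S_bounded.
  have xM : sqn xs <= M ^+ 2.
    by rewrite -sqr_enorm ler_pXn2r ?nnegrE ?sqrtr_ge0// S_bounded.
  have := sqn_ge0 (y + xs); rewrite sqnD sqnB /r; lra.
exists r; apply: ultra_near => U UU Uoo.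
have PU : ProperFilter U by exact: ultra_proper.
have [//|Ufar] := in_ultra_setVsetC [set k | sqn (s k - xs) <= r] UU.
have {}Ufar : \forall k \near U, r < sqn (s k - xs).
  by apply: filterS Ufar => k /= /negP; rewrite -ltNge.
(* The barycentric coordinate of the crossing with the sphere. *)
pose t k := Num.sqrt (r / sqn (s k - xs)).
pose w k := t k *: s k + (1 - t k) *: xs.
have wE k : w k - xs = t k *: (s k - xs).
  by apply/colP => i; rewrite !mxE; ring.
have t01 k : r < sqn (s k - xs) -> 0 < t k < 1.
  move=> rk; have sk0 := lt_trans r0 rk.
  rewrite sqrtr_gt0 divr_gt0//= -[X in _ < X]sqrtr1 ltr_sqrt// ltr_pdivrMr//.
  by rewrite mul1r.
have wr : \forall k \near U, sqn (w k - xs) = r.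
  apply: filterS Ufar => k rk; have sk0 := lt_trans r0 rk.
  by rewrite wE sqnZ sqr_sqrtr ?divr_ge0 ?ltW// divfK// gt_eqF.
have [p wp] : exists p : 'cV[R]_n, w k @[k --> U] --> p.
  apply: (@bounded_ultra_cvg _ _ _ _ _ _ xs r).
  by apply: filterS wr => k ->.
have pr : sqn (p - xs) = r.
  have wxs : w k - xs @[k --> U] --> p - xs.
    by apply: cvgB => //; exact: cvg_cst.
  have wsq : sqn (w k - xs) @[k --> U] --> sqn (p - xs) by exact: cvg_inner.
  have wcst : sqn (w k - xs) @[k --> U] --> r.
    apply: cvg_near_cst; exact: wr.
  by apply: cvg_unique wsq wcst; exact: norm_hausdorff.
have [pmin gp] : argmin_lsq A b p /\ (g p <= (fine (g xs))%:E)%E.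
  apply: (approx_solution_lim wp) => e e0.
  have near_value := Uoo _ (near_value_le e0).
  apply: filterS3 Ufar near_value (Uoo _ (near_gap_le e0)) => k rk gs gaps.
  have /andP[t0 t1] := t01 _ rk.
  have [gsf gse] := proper_le_fin g_proper gs.
  have [gw gwle] := econvex_fine g_proper g_convex (t01 _ rk) gsf
    solution_fin.
  split.
    rewrite -(fineK gw) lee_fin; apply: le_trans gwle _.
    have : t k * e <= e by rewrite ler_piMl// ltW.
    have := ler_wpM2l (ltW t0) gse; lra.
  apply: le_trans gaps; rewrite !(gapE _ solution_argmin) wE.
  rewrite -scalemxAr sqnZ ler_pM2l// ler_piMl ?sqn_ge0//.
  by rewrite expr_le1 ?(ltW t0) ?(ltW t1).
have psol : solutions g A b p.
  by apply: (solution_of_le pmin); rewrite -(fineK solution_fin).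
by have := S_r _ psol; rewrite pr ltxx.
Qed.

(** Wherever [k%:R * gap (s k)] exceeds [e], the penalized estimate puts
    [g (s k)] below the optimal value by nearly [sigma * e]; a limit of such
    points would be feasible with a value below the optimum. *)
Lemma penalized_gap_little e : 0 < e ->
  \forall k \near \oo, k%:R * gap (s k) <= e.
Proof.
move=> e0; have [r s_r] := penalized_bounded.
apply: ultra_near => U UU Uoo.
have PU : ProperFilter U by exact: ultra_proper.
have [//|Ufar] := in_ultra_setVsetC [set k | k%:R * gap (s k) <= e] UU.
have [p sp] : exists p : 'cV[R]_n, s k @[k --> U] --> p.
  by apply: (@bounded_ultra_cvg _ _ _ _ _ _ xs r); exact: Uoo.
have [pmin gp] :
    argmin_lsq A b p /\ (g p <= (fine (g xs) - sigma * e)%:E)%E.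
  apply: (approx_solution_lim sp) => d d0.
  have nearC := Uoo _ (near_div_le C d0).
  have {}Ufar : \forall k \near U, ~ k%:R * gap (s k) <= e /\ (0 < k)%N.
    exact: filterI Ufar (Uoo _ (nbhs_infty_gt 0%N)).
  apply: filterS3 Ufar nearC (Uoo _ (near_gap_le d0)).
  move=> k [/= /negP + k0] kd gaps; rewrite -ltNge => efar; split=> //.
  apply: le_trans (s_pen k0) _.
  rewrite lee_fin; move: efar; rewrite -(ltr_pM2l sigma_gt0); lra.
case: (xs_sol) => _ _ /(_ _ pmin) gxp.
have := le_trans gxp gp; rewrite -{1}(fineK solution_fin) lee_fin.
have := mulr_gt0 sigma_gt0 e0; lra.
Qed.

End Penalty.

(** * Convergence of the method *)

Theorem theorem1 (R : realType) (m n : nat)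
  (g : 'cV[R]_n -> \bar R) (A : 'M[R]_(m, n)) (b : 'cV[R]_m)
  (g_proper : proper_fun g) (g_convex : econvex g)
  (g_lsc : lower_semicontinuous g)
  (S_nonempty : solutions g A b !=set0)
  (tau lambda sigma : R) (tau_gt0 : 0 < tau) (lambda_gt0 : 0 < lambda)
  (step : lambda * opnorm A ^+ 2 < 1) (sigmaE : sigma = lambda / tau)
  (x s z : nat -> 'cV[R]_n)
  (s0E : s 0%N = x 0%N)
  (zE : forall k : nat, z k = (k.+1%:R)^-1 *: (x k + k%:R *: s k))
  (xE : forall k : nat,
     prox tau g (x k - (k.+1%:R * lambda) *: grad_lsq A b (z k)) (x k.+1))
  (sE : forall k : nat, s k.+1 = (k.+1%:R)^-1 *: (x k.+1 + k%:R *: s k)) :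
  [/\ (* (i) *)
      exists C : R, forall k : nat, (1 <= k)%N ->
        (penalized g A b sigma k (s k) - opt_val g A b <= (C / k%:R)%:E)%E,
      (* (ii) *)
      strong_duality g A b ->
        (exists2 xbar, solutions g A b xbar &
           (x k @[k --> \oo] --> xbar) /\ (s k @[k --> \oo] --> xbar)) /\
        [/\ (fun k : nat => (lsq A b (x k) - lsq_min A b : R^o))
              =O_\oo (fun k : nat => (k%:R^-1 : R^o)),
            (fun k : nat => (lsq A b (s k) - lsq_min A b : R^o))
              =O_\oo (fun k : nat => ((k%:R ^+ 2)^-1 : R^o)),
            ebigO (fun k : nat => penalized g A b sigma k (s k) - opt_val g A b)%E
              (fun k : nat => k%:R^-1) &
            ebigO (fun k : nat => g (s k) - opt_val g A b)%E
              (fun k : nat => k%:R^-1)]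
    & (* (iii) *)
      (exists M : R, forall y, solutions g A b y -> enorm y <= M) ->
      (exists c : R, forall y, (c%:E <= g y)%E) ->
        cluster (s k @[k --> \oo]) `<=` solutions g A b /\
        (fun k : nat => (lsq A b (s k) - lsq_min A b : R^o))
          =o_\oo (fun k : nat => (k%:R^-1 : R^o))].
Proof.
have [xs xs_sol] := S_nonempty.
have xs_min : argmin_lsq A b xs by case: xs_sol.
have xs_fin : g xs \is a fin_num by exact: solution_fin xs_sol.
subst sigma; have sigma_gt0 : 0 < lambda / tau by rewrite divr_gt0.
have {zE}xE k : prox tau g
    (x k - lambda *: (A^T *m (residual A x xs k + accum A s xs k))) (x k.+1).
  by rewrite -(momentum_gradE _ _ _ xs_min) -zE.
have gs_fin k : (0 < k)%N -> g (s k) \is a fin_num.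
  case: k => // k _.
  by have [] := ergodic_jensen g_proper g_convex tau_gt0 sE xE k.
pose D := sqn (x 0 - xs) / (2 * tau).
have value_le k : (0 < k)%N ->
    fine (g (s k)) + lambda / tau * k%:R * gap A b (s k) - fine (g xs) <=
    D / k%:R.
  move=> k0; have Axs : A *m (xs - xs) = 0 by rewrite subrr mulmx0.
  exact: (penalized_value_le g_proper g_convex tau_gt0 lambda_gt0 step xs_min
    sE xE k0 Axs xs_fin).
have optE := opt_valE xs_sol.
have penE k : (0 < k)%N ->
    (penalized g A b (lambda / tau) k (s k) - opt_val g A b =
    (fine (g (s k)) + lambda / tau * k%:R * gap A b (s k) - fine (g xs))%:E)%E.
  move=> k0; rewrite /penalized optE.
  by rewrite -(fineK (gs_fin _ k0)) -[in LHS](fineK xs_fin).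
split.
- exists D => k k0; rewrite penE// lee_fin; exact: value_le.
- move=> duality.
  have [y [q yq]] := strong_duality_kkt g_proper tau_gt0 lambda_gt0
    duality.
  have y_sol := kkt_solution g_proper tau_gt0 yq.
  split.
    have [p [r [pr xp]]] := iterates_cvg g_proper g_convex g_lsc
      tau_gt0 lambda_gt0 step xs_min sE xE yq.
    exists p; first exact: kkt_solution pr.
    by split=> //; exact: cesaro_col sE xp.
  have gyE : fine (g y) = fine (g xs).
    by rewrite -(opt_valE y_sol) optE.
  pose E := energy A lambda x s xs y q 0.
  have E_ge0 : 0 <= E by exact: energy_ge0.
  (* The dual iterates stay bounded, which is what the rate of [s] needs. *)
  pose B := 2 * (E / lambda + sqn q).
  have accumB k : sqn (accum A s xs k) <= B.
    exact: accum_bounded yq.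
  have c_gt0 := step_gap_gt0 step.
  pose L := lambda * (2^-1 * (sqn q + B)) / tau.
  have value_lb k : (0 < k)%N ->
      - (L / k%:R) <= fine (g (s k)) - fine (g xs).
    case: k => // k _.
    have := value_ge g_proper g_convex tau_gt0 lambda_gt0
      xs_min sE xE k yq.
    rewrite gyE => h; rewrite -mulNr ler_pdivrMr ?ltr0n// /L -mulNr.
    rewrite ler_pdivrMr//.
    have := ler_wpM2l (ltW lambda_gt0) (accumB k.+1); lra.
  have gap0 k := gap_ge0 (s k) xs_min.
  have D_ge0 : 0 <= D.
    by rewrite divr_ge0 ?sqn_ge0// mulr_ge0// ltW.
  have L_ge0 : 0 <= L.
    rewrite divr_ge0 ?(ltW tau_gt0)// mulr_ge0 ?(ltW lambda_gt0)//.
    rewrite mulr_ge0// addr_ge0 ?sqn_ge0//.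
    exact: le_trans (sqn_ge0 _) (accumB 0%N).
  have value_abs_le v k : - (L / k%:R) <= v -> v <= D / k%:R ->
      (`|v%:E| <= ((L + D) * `|k%:R^-1|)%:E)%E.
    move=> vL vD; rewrite abse_EFin lee_fin ler_norml.
    rewrite [`|_^-1|]ger0_norm ?invr_ge0//.
    have : 0 <= L / k%:R by rewrite divr_ge0.
    have : 0 <= D / k%:R by rewrite divr_ge0.
    by move=> ? ?; apply/andP; split; lra.
  have gap_term k : 0 <= lambda / tau * k%:R * gap A b (s k).
    by rewrite mulr_ge0 ?gap0// mulr_ge0// ltW.
  split.
  + apply/eqO_exP.
    exists (E / (lambda * (1 - lambda * opnorm A ^+ 2)) + 1).
      by rewrite ltr_wpDl// divr_ge0// mulr_ge0// ltW.
    exists 2%N => //= -[|[|k]]//= _.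
    rewrite -/(gap A b _) (gap_x _ xs_min).
    rewrite !ger0_norm ?invr_ge0 ?mulr_ge0 ?sqn_ge0//.
    rewrite ler_pdivlMr ?ltr0n//.
    suff : k.+2%:R * sqn (residual A x xs k.+2) <=
        2 * (E / (lambda * (1 - lambda * opnorm A ^+ 2))).
      by move: (E / _) => K; lra.
    rewrite mulrA ler_pdivlMr ?mulr_gt0// mulrC.
    exact: (residual_rate g_proper g_convex tau_gt0 lambda_gt0 step xs_min
      sE xE k yq).
  + apply/eqO_exP; exists (B + 1).
      by rewrite ltr_wpDl// (le_trans (sqn_ge0 _) (accumB 0%N)).
    near=> k.
    have k0 : (0 < k)%N by near: k; exact: nbhs_infty_gt.
    rewrite !ger0_norm ?invr_ge0 ?exprn_ge0//; last exact: gap0.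
    rewrite ler_pdivlMr ?exprn_gt0 ?ltr0n// mulrC.
    rewrite -/(gap A b _) (gap_s _ xs_min).
    have := accumB k; have := sqn_ge0 (accum A s xs k); lra.
  + exists (L + D); near=> k.
    have k0 : (0 < k)%N by near: k; exact: nbhs_infty_gt.
    rewrite penE//; apply: value_abs_le; last exact: value_le.
    have := value_lb _ k0; have := gap_term k; lra.
  + exists (L + D); near=> k.
    have k0 : (0 < k)%N by near: k; exact: nbhs_infty_gt.
    rewrite optE -(fineK (gs_fin _ k0)) -(fineK xs_fin) -EFinB.
    apply: value_abs_le; first exact: value_lb.
    have := value_le _ k0; have := gap_term k; lra.
- move=> [M SM] [c g_ge].
  have s_pen k : (0 < k)%N -> (g (s k) <=
      (fine (g xs) + D / k%:R - lambda / tau * k%:R * gap A b (s k))%:E)%E.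
    move=> k0; rewrite -(fineK (gs_fin _ k0)) lee_fin.
    have := value_le _ k0; lra.
  split=> [p|].
    exact: (cluster_solution g_proper g_lsc xs_sol sigma_gt0 s_pen g_ge).
  apply/eqoP => e e0; near=> k.
  have k0 : (0 < k)%N by near: k; exact: nbhs_infty_gt.
  rewrite !ger0_norm ?invr_ge0 ?ler0n//; last first.
    exact: (gap_ge0 (s k) xs_min).
  rewrite ler_pdivlMr ?ltr0n// mulrC; near: k.
  exact: (penalized_gap_little g_proper g_convex g_lsc xs_sol
    sigma_gt0 s_pen g_ge SM).
Unshelve. all: by end_near. Qed.
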